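(* Let $K=\langle S_K\mid R_K\rangle$ be a finitely generated free abelian group and let $A$ be a subgroup of $K$. If $f$ is an automorphism of $K$ of finite order, then the HNN-extension $$G=\langle S_K,\ t \mid R_K,\ tat^{-1}=f(a),\ a\in A\rangle$$ is $\mathbb{Z}$-linear.
   Context: A group is called $\mathbb{Z}$-linear (linear over $\mathbb{Z}$) if it admits a faithful representation into $GL_n(\mathbb{Z})$ for some $n$. Here $\langle S_K\mid R_K\rangle$ is a fixed presentation of $K$, and $G$ is the HNN-extension with base $K$, stable letter $t$ and associated subgroups $A$ and $f(A)$. *)

(* Defs.v *)
From HB Require Import structures.
From mathcomp Require Import all_boot all_order all_algebra.
From mathcomp Require Import boolp classical_sets.

Set Implicit Arguments.
Unset Strict Implicit.
Unset Printing Implicit Defensive.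

Import GRing.Theory.

Local Open Scope classical_set_scope.
Local Open Scope quotient_scope.
Local Open Scope group_scope.

(* A letter (s, b) stands for the generator s if b = false, and for its       *)
(* formal inverse if b = true.                                                *)
Definition word (S : choiceType) := seq (S * bool).

HB.instance Definition _ (S : choiceType) := Choice.on (word S).

Definition winv (S : choiceType) (w : word S) : word S :=
  rev [seq (l.1, ~~ l.2) | l <- w].

(* The congruence on words whose quotient is < S | R >, where R is a set of   *)
(* relators.                                                                  *)
Inductive pres_eq (S : choiceType) (R : set (word S)) :
    word S -> word S -> Prop :=
| pres_refl u : pres_eq R u u
| pres_sym u v : pres_eq R u v -> pres_eq R v u
| pres_trans u v w : pres_eq R u v -> pres_eq R v w -> pres_eq R u w
| pres_cancel u v s b : pres_eq R (u ++ [:: (s, b); (s, ~~ b)] ++ v) (u ++ v)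
| pres_relator u v r : R r -> pres_eq R (u ++ r ++ v) (u ++ v).

Section Presentation.
Variables (S : choiceType) (R : set (word S)).
Implicit Types u v w r : word S.

Lemma winvK : involutive (@winv S).
Proof.
move=> w; rewrite /winv map_rev revK -map_comp -[RHS]map_id.
by apply: eq_map => -[s b] /=; rewrite negbK.
Qed.

Lemma winv_cat u v : winv (u ++ v) = winv v ++ winv u.
Proof. by rewrite /winv map_cat rev_cat. Qed.

Lemma pres_eq_catl w u v : pres_eq R u v -> pres_eq R (w ++ u) (w ++ v).
Proof.
elim=> {u v} [u|u v _|u v x _ uv _ vx|u v s b|u v r Rr].
- exact: pres_refl.
- exact: pres_sym.
- exact: pres_trans uv vx.
- by rewrite !(catA w); apply: pres_cancel.
- by rewrite !(catA w); apply: pres_relator.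
Qed.

Lemma pres_eq_catr w u v : pres_eq R u v -> pres_eq R (u ++ w) (v ++ w).
Proof.
elim=> {u v} [u|u v _|u v x _ uv _ vx|u v s b|u v r Rr].
- exact: pres_refl.
- exact: pres_sym.
- exact: pres_trans uv vx.
- by rewrite -!catA; apply: pres_cancel.
- by rewrite -!catA; apply: pres_relator.
Qed.

Lemma pres_eq_cat u u' v v' :
  pres_eq R u u' -> pres_eq R v v' -> pres_eq R (u ++ v) (u' ++ v').
Proof.
move=> uu' vv'; apply: pres_trans (pres_eq_catr v uu') _.
exact: pres_eq_catl.
Qed.

Lemma pres_eq_winvr u : pres_eq R (u ++ winv u) [::].
Proof.
elim: u => [|[s b] u IHu]; first exact: pres_refl.
have -> : ((s, b) :: u) ++ winv ((s, b) :: u)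
          = [:: (s, b)] ++ (u ++ winv u) ++ [:: (s, ~~ b)].
  by rewrite -[(s, b) :: u]/([:: (s, b)] ++ u) winv_cat !catA.
apply: pres_trans (pres_eq_catl _ (pres_eq_catr _ IHu)) _.
exact: (pres_cancel R [::] [::]).
Qed.

Lemma pres_eq_winvl u : pres_eq R (winv u ++ u) [::].
Proof. by rewrite -{2}[u]winvK; apply: pres_eq_winvr. Qed.

Lemma pres_eq_winv u v : pres_eq R u v -> pres_eq R (winv u) (winv v).
Proof.
move=> uv.
have h1 : pres_eq R (winv u) (winv u ++ v ++ winv v).
  rewrite -{1}[winv u]cats0; apply: pres_eq_catl.
  exact/pres_sym/pres_eq_winvr.
apply: pres_trans h1 _; rewrite catA -[X in pres_eq R _ X]cat0s.
apply: pres_eq_catr; apply: pres_trans (pres_eq_winvl u).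
exact/pres_eq_catl/pres_sym.
Qed.

Definition pres_rel : rel (word S) := fun u v => `[< pres_eq R u v >].

Lemma pres_rel_equiv : equiv_class_of pres_rel.
Proof.
split=> [u|u v|v u w].
- exact/asboolP/pres_refl.
- by apply/asboolP/asboolP => /pres_sym.
- by move=> /asboolP uv /asboolP vw; apply/asboolP/(pres_trans uv).
Qed.

Canonical pres_equiv := EquivRelPack pres_rel_equiv.

Definition pres_group := {eq_quot pres_equiv}.

HB.instance Definition _ := Choice.on pres_group.
HB.instance Definition _ := Quotient.on pres_group.

Definition pres_class (w : word S) : pres_group := \pi_pres_group w.

Lemma pres_classP u v : pres_class u = pres_class v <-> pres_eq R u v.
Proof.
by split=> [/eqmodP/asboolP|uv] //; apply/eqmodP/asboolP.
Qed.

Lemma pres_class_repr (x : pres_group) : pres_class (repr x) = x.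
Proof. exact: reprK. Qed.

Lemma pres_eq_repr u : pres_eq R (repr (pres_class u)) u.
Proof. exact/pres_classP/pres_class_repr. Qed.

Definition pres_mul (x y : pres_group) : pres_group :=
  pres_class (repr x ++ repr y).
Definition pres_one : pres_group := pres_class [::].
Definition pres_inv (x : pres_group) : pres_group := pres_class (winv (repr x)).

Lemma pres_mulE u v :
  pres_mul (pres_class u) (pres_class v) = pres_class (u ++ v).
Proof. by apply/pres_classP/pres_eq_cat; apply: pres_eq_repr. Qed.

Lemma pres_invE u : pres_inv (pres_class u) = pres_class (winv u).
Proof. exact/pres_classP/pres_eq_winv/pres_eq_repr. Qed.

Lemma pres_mulA : associative pres_mul.
Proof.
move=> x y z; rewrite -[x]pres_class_repr -[y]pres_class_repr.
by rewrite -[z]pres_class_repr !pres_mulE catA.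
Qed.

Lemma pres_mul1 : left_id pres_one pres_mul.
Proof. by move=> x; rewrite -[x]pres_class_repr pres_mulE. Qed.

Lemma pres_mulr1 : right_id pres_one pres_mul.
Proof. by move=> x; rewrite -[x]pres_class_repr pres_mulE cats0. Qed.

Lemma pres_mulV : left_inverse pres_one pres_inv pres_mul.
Proof.
move=> x; rewrite -[x]pres_class_repr pres_invE pres_mulE.
exact/pres_classP/pres_eq_winvl.
Qed.

Lemma pres_mulrV : right_inverse pres_one pres_inv pres_mul.
Proof.
move=> x; rewrite -[x]pres_class_repr pres_invE pres_mulE.
exact/pres_classP/pres_eq_winvr.
Qed.

HB.instance Definition _ := isGroup.Build pres_group
  pres_mulA pres_mul1 pres_mulr1 pres_mulV pres_mulrV.

End Presentation.

(* HNN-extension of K = < S | R >: the generators are S and the stable letter *)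
(* t = None. Since an element of K is a class of words over S, the relation   *)
(* t a t^-1 = f a is imposed for all words u and v that represent a and f a.  *)
Definition hnn_word (S : choiceType) (w : word S) : word (option S) :=
  [seq (Some l.1, l.2) | l <- w].

Definition hnn_relators (S : choiceType) (R : set (word S))
    (A : {pred pres_group R}) (f : pres_group R -> pres_group R) :
    set (word (option S)) :=
  [set r | (exists2 u, R u & r = hnn_word u) \/
           (exists u v, [/\ pres_class R u \in A,
              f (pres_class R u) = pres_class R v &
              r = [:: (None, false)] ++ hnn_word u ++ [:: (None, true)]
                    ++ winv (hnn_word v)])].

Definition hnn_group (S : choiceType) (R : set (word S))
    (A : {pred pres_group R}) (f : pres_group R -> pres_group R) : groupType :=
  pres_group (hnn_relators A f).

Definition fg_free_abelian (K : groupType) : Prop :=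
  exists (n : nat) (e : 'rV[int]_n -> K),
    (forall x y, e (x + y)%R = e x * e y) /\ bijective e.

Definition Z_linear (G : groupType) : Prop :=
  exists (n : nat) (rho : G -> 'M[int]_n),
    [/\ forall g, rho g \in unitmx,
        forall g h, rho (g * h) = (rho g *m rho h)%R &
        injective rho].

(* Main.v *)
From HB Require Import structures.
Require Import Defs.
From mathcomp Require Import all_boot all_order all_algebra.
From mathcomp Require Import boolp classical_sets.
From mathcomp Require Import ring zify.

(** Let M >= 2 be such that f ^ M = 1. The group G maps to the semidirect product
of K by Z/M, where t acts by f, and K embeds there; so the kernel of this map
meets every conjugate of K trivially. The proof lets G act on a lattice in
such a way that this kernel acts through a group generated by reflections in
vectors indexed by cosets, any two of which have inner product at most -2
(their squared length being 2). Such a reflection group is a free product of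
groups of order two, and the usual positivity argument for Coxeter groups
detects every reduced word. It uses signs only: no growth estimates enter.

In detail, a separating coefficient for A is a K-lattice V with a linear form
ev and a vector b, both fixed by A, such that the function k |-> ev (k b)
vanishes on A and is at least 1 elsewhere. Such coefficients exist for the
kernel of a homomorphism l to the integers (the coefficient l ^ 2 lives on
polynomials of degree at most two in l), for stabilizers of points of finite
K-sets, and for intersections. Every subgroup of a free abelian group of
finite rank is the intersection of finitely many such kernels and of a
subgroup of finite index (subgroup_kernel_congruence), which gives
separable_subgroup.

Given a separating coefficient, induce the direct sum of the trivial lattice
and V from K to the extension of K by Z/M: a vector is a family (w_i), i in
Z/M, the element k acts on w_i through f ^ i (k), and shift moves the indices.
A vector w takes a value at each point (i, k), namely that of the form
(c, v) |-> c + ev v at the translate of w_i by k. The root has value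
2 - 4 ev (k b) at (0, k) and -2 at the other points, so value 2 at the points
(0, a) with a in A, and at most -2 at all others. The reflection r in this root
commutes with A, hence t |-> shift o r satisfies t a t^-1 = f a and defines an
action of G (hnn_action). In a Britton-reduced word, two successive
reflections are separated by an operator that moves the base point (0, 1) off
the coset of A: if the letters t^e and t^e' around k are opposite this is what
reducedness says, and if they are equal the index i changes, as M >= 2.
After each reflection the vector is therefore negative at the base point, and
positive and larger in absolute value at all points off the coset of A
(flipped_next). In particular, a reduced word that involves t moves the vector
with all values equal to 1.

Words without t are detected by a second action of G, on Z^n x Z, where K
acts by affine translations and t by f. The direct sum of both actions is
faithful. *)

Set Implicit Arguments.
Unset Strict Implicit.
Unset Printing Implicit Defensive.

Import Order.TTheory GRing.Theory Num.Theory.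
Local Open Scope group_scope.

(** * Actions on lattices *)

Definition additive_action (G : groupType) (V : zmodType) (act : G -> V -> V) :=
  [/\ forall v, act 1 v = v,
      forall g h v, act (g * h) v = act g (act h v) &
      forall g, {morph act g : u v / (u + v)%R}].

Lemma morphD_Mz (V W : zmodType) (f : V -> W) :
  {morph f : u v / (u + v)%R} -> forall v c, f (v *~ c)%R = (f v *~ c)%R.
Proof.
move=> fD v; have f0 : f 0%R = 0%R.
  by apply: (addrI (f 0%R)); rewrite -fD !addr0.
have fN u : f (- u)%R = (- f u)%R.
  by apply: (addrI (f u)); rewrite -fD !subrr.
have fMn n : f (v *+ n)%R = (f v *+ n)%R.
  by elim: n => [|n IHn]; rewrite ?mulr0n // !mulrS fD IHn.
by case=> n; rewrite /intmul ?fN fMn.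
Qed.

Lemma morphD_linear (V W : lmodType int) (f : V -> W) :
  {morph f : u v / (u + v)%R} -> linear f.
Proof.
by move=> fD a u v; rewrite fD -(intz a) !scaler_int morphD_Mz.
Qed.

(** The matrices are transposed because lin1_mx acts on row vectors from the
right, which reverses products. *)
Lemma Z_linear_of_action (G : groupType) (V : vectType int)
    (act : G -> V -> V) :
  additive_action act -> (forall g, act g =1 id -> g = 1) -> Z_linear G.
Proof.
move=> [act1 actM actD] act_faithful.
have [v2r [_ v2rD] [r2v v2rK r2vK]] := @vector.vector_subdef int V.
have r2vD : {morph r2v : u v / (u + v)%R}.
  by move=> u v; rewrite -{1}[u]r2vK -{1}[v]r2vK -v2rD v2rK.
pose M g := lin1_mx (fun u => v2r (act g (r2v u))).
have ME g u : (u *m M g)%R = v2r (act g (r2v u)).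
  have lin : linear (fun u : 'rV[int]_(vector.dim V) => v2r (act g (r2v u))).
    apply: morphD_linear => x y.
    by rewrite r2vD actD v2rD.
  pose F := GRing.isLinear.Build _ _ _ _ _ lin.
  pose L : {linear 'rV[int]_(vector.dim V) -> 'rV[int]_(vector.dim V)} :=
    HB.pack (fun u => v2r (act g (r2v u))) F.
  exact: (mul_rV_lin1 L).
have M1 : M 1 = 1%:M%R.
  by apply/row_matrixP => i; rewrite !rowE ME act1 r2vK mulmx1.
have MM g h : M (g * h) = (M h *m M g)%R.
  by apply/row_matrixP => i; rewrite !rowE mulmxA !ME v2rK actM.
exists (vector.dim V), (fun g => (M g)^T%R); split.
- move=> g; rewrite unitmx_tr.
  have /mulmx1_unit[] // : (M g *m M (g^-1)%g = 1%:M)%R by rewrite -MM mulVg M1.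
- by move=> g h; rewrite MM trmx_mul.
- move=> g h /(can_inj (@trmxK _ _ _)) Mgh.
  suff : h^-1 * g = 1 by move/(canRL (mulKg _)); rewrite ?invgK ?mulg1.
  apply: act_faithful => v; apply: (can_inj v2rK).
  by rewrite -[v in LHS]v2rK -ME MM Mgh -MM mulVg ME act1.
Qed.

(** * Separating coefficients *)

(** The function k |-> ev (act k b) is a matrix coefficient that is constant on
the double cosets of A; it serves as the distance between the cosets A and kA
in the reflection representation below. *)
Record separating_coef (K : groupType) (A : K -> Prop) (V : zmodType)
    (act : K -> V -> V) (ev : V -> int) (b : V) : Prop := SeparatingCoef {
  sep_action : additive_action act;
  sep_evD : {morph ev : u v / (u + v)%R};
  sep_ev_inv : forall a v, A a -> ev (act a v) = ev v;
  sep_b_inv : forall a, A a -> act a b = b;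
  sep_b0 : ev b = 0%R;
  sep_ge1 : forall k, ~ A k -> (1 <= ev (act k b))%R
}.

Definition separable (K : groupType) (A : K -> Prop) : Prop :=
  exists (V : vectType int) (act : K -> V -> V) (ev : V -> int) (b : V),
    separating_coef A act ev b.

Lemma eq_separable (K : groupType) (A B : K -> Prop) :
  (forall k, A k <-> B k) -> separable A -> separable B.
Proof.
move=> AB; suff -> : B = A by [].
by apply: funext => k; apply/propext; split=> /AB.
Qed.

(** On the direct sum the coefficients add up, and both are nonnegative. *)
Lemma separableI (K : groupType) (A B : K -> Prop) :
  separable A -> separable B -> separable (fun k => A k /\ B k).
Proof.
move=> [V [actV [evV [bV [[V1 VM VD] evVD evVA bVA bV0 VgeA]]]]].
move=> [W [actW [evW [bW [[W1 WM WD] evWD evWB bWB bW0 WgeB]]]]].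
pose act k (x : V * W) := (actV k x.1, actW k x.2).
pose ev (x : V * W) := (evV x.1 + evW x.2)%R.
exists [the vectType int of (V * W)%type], act, ev, (bV, bW); split.
- split=> [[v w]|g h [v w]|g [v w] [v' w']]; rewrite /act /=.
  + by rewrite V1 W1.
  + by rewrite VM WM.
  + by rewrite VD WD.
- by move=> u v; rewrite /ev /= evVD evWD addrACA.
- by move=> a v [Aa Ba]; rewrite /ev /= evVA ?evWB.
- by move=> a [Aa Ba]; rewrite /act /= bVA ?bWB.
- by rewrite /ev /= bV0 bW0.
move=> k nABk; rewrite /ev /=.
have V_ge0 : (0 <= evV (actV k bV))%R.
  case: (pselect (A k)) => [Ak|/VgeA]; last exact: le_trans.
  by rewrite bVA ?bV0.
have W_ge0 : (0 <= evW (actW k bW))%R.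
  case: (pselect (B k)) => [Bk|/WgeB]; last exact: le_trans.
  by rewrite bWB ?bW0.
case: (pselect (A k)) => [Ak|/VgeA]; last by lia.
case: (pselect (B k)) => [Bk|/WgeB]; last by lia.
by case: nABk.
Qed.

(** The coefficient is l ^ 2: a triple (x, y, z) is the polynomial
x + y l + z l ^ 2, on which k acts by the translation l |-> l + l k, and ev is
the evaluation at l = 0. *)
Lemma separable_kernel (K : groupType) (l : K -> int) :
  {morph l : g h / g * h >-> (g + h)%R} -> separable (fun k => l k = 0%R).
Proof.
move=> lM; have l1 : l 1 = 0%R by have := lM 1 1; rewrite mulg1; lia.
pose V := [the vectType int of (int^o * int^o * int^o)%type].
pose act k (x : V) : V :=
  (x.1.1 + l k * x.1.2 + l k * l k * x.2,
   x.1.2 + 2 * l k * x.2, x.2)%R.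
pose ev (x : V) : int := x.1.1.
exists V, act, ev, (0, 0, 1)%R; split.
- split=> [[[x y] z]|g h [[x y] z]|g [[x y] z] [[x' y'] z']];
    rewrite /act /= ?l1 ?lM; congr (_, _, _) => /=; ring.
- by case=> [[x y] z] [[x' y'] z'].
- by move=> a [[x y] z] la; rewrite /ev /act /= la; ring.
- by move=> a la; rewrite /act /= la; congr (_, _, _); ring.
- by [].
- by move=> k lk; rewrite /ev /act /=; nia.
Qed.

Lemma separable_kernels (K : groupType) (I : Type) (s : seq I)
    (l : I -> K -> int) :
  (forall i, {morph l i : g h / g * h >-> (g + h)%R}) ->
  separable (fun k => all (fun i => l i k == 0%R) s).
Proof.
move=> lM; elim: s => [|i s IHs].
  apply: (@eq_separable _ (fun k => (0%R : int) = 0%R)) => [k|] //.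
  by apply: separable_kernel => ? ?; rewrite addr0.
apply: eq_separable (separableI (separable_kernel (lM i)) IHs) => k /=.
by split=> [[-> ->]|/andP[/eqP]] //; rewrite eqxx.
Qed.

(** Functions on X, with ev the evaluation at x0 and b the indicator of the
complement of x0. *)
Lemma separable_stabilizer (K : groupType) (X : finType) (op : X -> K -> X)
    (x0 : X) :
  (forall x, op x 1 = x) -> (forall x g h, op x (g * h) = op (op x g) h) ->
  separable (fun k => op x0 k = x0).
Proof.
move=> op1 opM.
pose V := [the vectType int of {ffun X -> int^o}].
pose act k (v : V) : V := [ffun x => v (op x k)].
pose ev (v : V) : int := v x0.
pose b : V := [ffun x => (x != x0)%:R%R].
exists V, act, ev, b; split.
- split=> [v|g h v|g v w]; apply/ffunP => x; rewrite !ffunE.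
  + by rewrite op1.
  + by rewrite opM.
  + by [].
- by move=> u v; rewrite /ev ffunE.
- by move=> a v op_a; rewrite /ev /act ffunE op_a.
- move=> a op_a; apply/ffunP => x; rewrite !ffunE -{1}op_a.
  have opK : cancel (op^~ a) (op^~ a^-1) by move=> y; rewrite -opM mulgV op1.
  by rewrite (can_eq opK).
- by rewrite /ev ffunE eqxx.
- by move=> k /eqP; rewrite /ev /act !ffunE => ->.
Qed.

(** * Subgroups of free abelian groups *)

Lemma common_denominator (s : seq rat) :
  exists2 N : nat, (0 < N)%N & all (fun x => x * N%:R \is a Num.int)%R s.
Proof.
elim: s => [|x s [N N_gt0 sN]]; first by exists 1%N.
have dE : (`|denq x|%:R = (denq x)%:~R :> rat)%R.
  by rewrite -[RHS]/((denq x)%:~R)%R -{2}[denq x]absz_denq.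
exists (`|denq x| * N)%N; first by rewrite muln_gt0 N_gt0 absz_gt0 denq_neq0.
rewrite /= natrM dE mulrA -numqE rpredM ?rpred_int ?rpred_nat //=.
apply: sub_all sN => y; rewrite mulrCA => yN.
by rewrite rpredM ?rpred_int.
Qed.

Lemma integral_multiple m n (C : 'M[rat]_(m, n)) :
  exists N : nat, exists2 C' : 'M[int]_(m, n),
    (0 < N)%N & (map_mx intr C' = N%:R *: C :> 'M[rat]_(m, n))%R.
Proof.
have [N N_gt0 /allP CN] :=
  common_denominator [seq C u.1 u.2 | u <- enum {: 'I_m * 'I_n}].
exists N, (\matrix_(i, j) Num.floor (C i j * N%:R))%R => //.
apply/matrixP => i j; rewrite !mxE mulrC.
apply/eqP; rewrite mulrC -intrEfloor; apply/(CN (C i j))/mapP.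
by exists (i, j); rewrite ?mem_enum.
Qed.

Lemma map_intr_inj m n :
  injective (map_mx intr : 'M[int]_(m, n) -> 'M[rat]_(m, n)).
Proof.
move=> B C /matrixP BC; apply/matrixP => i j.
by have := BC i j; rewrite !mxE => /intr_inj.
Qed.

Section SubgroupsOfZn.
Variables (n : nat) (A : 'rV[int]_n -> Prop).
Hypotheses (A0 : A 0%R) (AB : forall x y, A x -> A y -> A (x - y)%R).

Local Notation toQ := (map_mx (intr : int -> rat)).

Let AN x : A x -> A (- x)%R. Proof. by move=> Ax; rewrite -sub0r; apply: AB. Qed.

Let AD x y : A x -> A y -> A (x + y)%R.
Proof. by move=> Ax Ay; rewrite -[y]opprK; apply: AB => //; apply: AN. Qed.

Let AMn x k : A x -> A (x *+ k)%R.
Proof.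
by move=> Ax; elim: k => [|k IHk]; rewrite ?mulr0n // mulrS; apply: AD.
Qed.

Let AZ k x : A x -> A (k *: x)%R.
Proof.
move=> Ax; rewrite -(intz k) scaler_int.
by case: k => k; rewrite /intmul; [|apply: AN]; apply: AMn.
Qed.

Let A_mulmx r (B : 'M[int]_(r, n)) (y : 'rV_r) :
  (forall i, A (row i B)) -> A (y *m B)%R.
Proof.
by move=> rB; rewrite mulmx_sum_row; elim/big_ind: _ => // i _; apply: AZ.
Qed.

(** A matrix of maximal rank among those with rows in A spans A rationally, as
any further row of A would otherwise raise the rank. *)
Lemma maximal_rank_rows :
  exists r (B : 'M[int]_(r, n)),
    (forall i, A (row i B)) /\
    forall a, A a -> (toQ a <= toQ B)%MS.
Proof.
pose P d := `[< exists r (B : 'M[int]_(r, n)),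
                  (forall i, A (row i B)) /\ \rank (toQ B) = d >].
have P0 : exists d, P d.
  exists (\rank (toQ (0 : 'M[int]_(0, n))))%R; apply/asboolP.
  by exists 0%N, 0%R; split=> // -[].
have Pmax d : P d -> (d <= n)%N.
  by case/asboolP=> r [B [_ <-]]; apply: rank_leq_col.
case: (ex_maxnP P0 Pmax) => d /asboolP [r [B [rB dB]]] maxd.
exists r, B; split=> // a Aa.
have /maxd : P (\rank (toQ (col_mx a B))).
  apply/asboolP; exists _, (col_mx a B); split=> // i.
  case: (split_ordP i) => j ->; rewrite ?rowKu ?rowKd //.
  by rewrite [j]ord1 (_ : row 0%R a = a) //; apply/rowP => l; rewrite mxE.
have BaB : (toQ B <= col_mx (toQ a) (toQ B))%MS.
  by rewrite -addsmxE addsmxSr.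
rewrite map_col_mx -dB (geq_leqif (mxrank_leqif_sup BaB)).
by apply: submx_trans; rewrite -addsmxE addsmxSl.
Qed.

(** The matrix L cuts out the integral points x of the rational span of A, which
contain A with a quotient of bounded exponent: if N2 clears the denominators of
the coordinates of x with respect to rows in A that span A rationally, then
N2 x is in A. Hence a point of the span that is congruent to one of A modulo N2
differs from it by N2 y with y in the span, and so lies in A. *)
Lemma subgroup_kernel_congruence :
  exists (L : 'M[int]_n) (N : nat), (1 < N)%N /\
    forall x, A x <-> (x *m L)%R = 0%R /\
                      exists a y, A a /\ (x = a + y *+ N)%R.
Proof.
have [r [B [rB spanB]]] := maximal_rank_rows.
have [N1 [L N1_gt0 LE]] := integral_multiple (cokermx (toQ B)).
have [N2 [Q N2_gt0 QE]] := integral_multiple (pinvmx (toQ B)).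
have LP (x : 'rV_n) : (x *m L)%R = 0%R <-> (toQ x <= toQ B)%MS.
  have N1_neq0 : (N1%:R != 0 :> rat)%R by rewrite pnatr_eq0 -lt0n.
  rewrite submxE -(inj_eq (scalerI N1_neq0)) scaler0 scalemxAr -LE -map_mxM.
  rewrite -[0%R in X in _ <-> X](map_mx0 intr).
  by split=> [->|/eqP/map_intr_inj].
have A_N2 y : (toQ y <= toQ B)%MS -> A (y *+ N2)%R.
  move=> yB; suff -> : (y *+ N2 = (y *m Q) *m B)%R by apply: A_mulmx.
  apply: map_intr_inj.
  rewrite !map_mxM QE -scalemxAr -scalemxAl mulmxKpV // scaler_nat.
  by rewrite raddfMn.
(* The factor 2 only ensures that the modulus is at least 2, as 'Z_N needs. *)
exists L, (N2 * 2)%N; split; first by lia.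
move=> x; split=> [Ax|[xL [a [y [Aa xE]]]]].
  by split; [apply/LP/spanB|exists x, 0%R; rewrite mul0rn addr0].
have /LP aL := spanB _ Aa.
rewrite xE mulrnA; apply/AD/AMn/A_N2/LP => //.
move: xL; rewrite xE mulmxDl aL add0r -scaler_nat -scalemxAl => yL.
apply/matrixP => i j; move/matrixP/(_ i j): yL.
by rewrite !mxE; lia.
Qed.

End SubgroupsOfZn.

Lemma intr_Zp_eq0 N (z : int) : (1 < N)%N ->
  (z%:~R == 0 :> 'Z_N)%R = (N %| z)%Z.
Proof.
move=> N_gt1; have natP k : (k%:R == 0 :> 'Z_N)%R = (N %| k)%N.
  by rewrite -val_eqE /= val_Zp_nat.
by case: z => k; rewrite dvdzE /intmul ?oppr_eq0 natP.
Qed.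

Lemma map_mx_Zp_eq m n N (x y : 'M[int]_(m, n)) : (1 < N)%N ->
  (map_mx intr x = map_mx intr y :> 'M['Z_N]_(m, n)) <->
  exists z, (x = y + z *+ N)%R.
Proof.
move=> N_gt1; split=> [/matrixP xy|[z ->]]; last first.
  apply/matrixP => i j; rewrite -scaler_nat !mxE intrD intrM.
  by rewrite natz [N%:~R%R]pchar_Zp // mul0r addr0.
exists (\matrix_(i, j) ((x i j - y i j) %/ N)%Z)%R.
apply/matrixP => i j; rewrite -scaler_nat; have := xy i j; rewrite !mxE => /eqP.
rewrite -subr_eq0 -rmorphB intr_Zp_eq0 // => /divzK.
by rewrite natz mulrC => ->; rewrite addrC subrK.
Qed.

(** The congruence condition is a stabilizer: K acts by translations on the
subsets of (Z/N)^n, and an element fixes the image of A exactly when it is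
congruent to an element of A. *)
Lemma separable_subgroup (K : groupType) (A : groupClosed K) :
  fg_free_abelian K -> separable (fun k => k \in A).
Proof.
move=> [n [e [eD [e' e'K eK]]]].
have e'M g h : e' (g * h) = (e' g + e' h)%R.
  by apply: (can_inj e'K); rewrite eD !eK.
have e'1 : e' 1 = 0%R by apply: (addrI (e' 1)); rewrite -e'M mulg1 addr0.
have e0 : e 0%R = 1 by rewrite -e'1 eK.
have eN x : e (- x)%R = (e x)^-1.
  by apply: (mulgI (e x)); rewrite -eD subrr mulgV.
pose A' x := e x \in A.
have A0 : A' 0%R by rewrite /A' e0 gpred1.
have AB x y : A' x -> A' y -> A' (x - y)%R.
  by move=> Ax Ay; rewrite /A' eD eN gpredF.
have [L [N [N_gt1 A'P]]] := subgroup_kernel_congruence A0 AB.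
pose theta (x : 'rV[int]_n) : 'rV['Z_N]_n := map_mx intr x.
have thetaD x y : theta (x + y)%R = (theta x + theta y)%R by apply: map_mxD.
pose x0 : {set 'rV['Z_N]_n} := [set w | `[< exists2 a, A' a & w = theta a >]].
pose op (X : {set 'rV['Z_N]_n}) k := [set (x + theta (e' k))%R | x in X].
have op1 X : op X 1 = X.
  rewrite /op e'1 /theta map_mx0 -[RHS]imset_id.
  by apply: eq_imset => x; rewrite addr0.
have opM X g h : op X (g * h) = op (op X g) h.
  rewrite /op e'M thetaD -imset_comp.
  by apply: eq_imset => x /=; rewrite addrA.
have x0D w a : w \in x0 -> A' a -> (w + theta a)%R \in x0.
  rewrite inE => /asboolP[c Ac ->] Aa; rewrite inE.
  apply/asboolP; exists (c + a)%R.
    by rewrite /A' eD gpredM.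
  by rewrite thetaD.
have stabP k : op x0 k = x0 <-> exists a y, A' a /\ (e' k = a + y *+ N)%R.
  split=> [op_k|[a [y [Aa kE]]]].
    have : theta (e' k) \in x0.
      rewrite -op_k; apply/imsetP; exists 0%R; rewrite ?add0r // inE.
      by apply/asboolP; exists 0%R; rewrite ?/theta ?map_mx0.
    rewrite inE => /asboolP[a Aa /(map_mx_Zp_eq _ _ N_gt1)[y kE]].
    by exists a, y.
  have thE : theta (e' k) = theta a.
    by apply/(map_mx_Zp_eq _ _ N_gt1); exists y.
  apply/setP => w; rewrite /op thE; apply/imsetP/idP => [[x x_in ->]|w_in].
    exact: x0D.
  exists (w + theta (- a))%R; last first.
    by rewrite -addrA -thetaD addNr /theta map_mx0 addr0.
  by apply: x0D => //; rewrite /A' eN gpredV.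
have ker_sep : separable (fun k => (e' k *m L)%R = 0%R).
  pose l (i : 'I_n) k : int := (e' k *m L)%R 0%R i.
  have lM i : {morph l i : g h / g * h >-> (g + h)%R}.
    by move=> g h; rewrite /l e'M mulmxDl mxE.
  apply: eq_separable (separable_kernels (enum 'I_n) lM) => k; split.
    move/allP => kL; apply/rowP => i; rewrite [RHS]mxE.
    by have := kL i; rewrite mem_enum => /(_ isT)/eqP.
  by move=> kL; apply/allP => i _; rewrite /l kL mxE.
apply: eq_separable (separableI ker_sep (separable_stabilizer x0 op1 opM)) => k.
rewrite stabP -A'P /A' eK; split=> //.
Qed.

(** * Normal forms and actions of HNN-extensions *)

Lemma pres_classM (S : choiceType) (R : set (word S)) (u v : word S) :
  pres_class R (u ++ v) = pres_class R u * pres_class R v.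
Proof. by symmetry; apply: pres_mulE. Qed.

Lemma pres_classV (S : choiceType) (R : set (word S)) (u : word S) :
  pres_class R (winv u) = (pres_class R u)^-1.
Proof. by symmetry; apply: pres_invE. Qed.

Lemma pres_class_letterV (S : choiceType) (R : set (word S)) (s : S) b :
  pres_class R [:: (s, b)] * pres_class R [:: (s, ~~ b)] = 1.
Proof.
by rewrite -pres_classM; apply/pres_classP; apply: (pres_cancel R [::] [::]).
Qed.

Lemma pres_class_relator (S : choiceType) (R : set (word S)) (r : word S) :
  R r -> pres_class R r = 1.
Proof.
move=> Rr; apply/pres_classP; have := pres_relator [::] [::] Rr.
by rewrite cats0.
Qed.

Lemma winv_hnn_word (S : choiceType) (u : word S) :
  winv (hnn_word u) = hnn_word (winv u).
Proof. by rewrite /winv /hnn_word map_rev -!map_comp. Qed.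

(** A letter is t if the boolean is false and t^-1 if it is true; the pinches
are the words t a t^-1 and t^-1 (f a) t, with a in A, of Britton's lemma. *)
Definition pinch (K : groupType) (A : {pred K}) (f : K -> K)
    (b : bool) (k : K) (b' : bool) : Prop :=
  b' = ~~ b /\ if b then exists2 a, a \in A & k = f a else k \in A.

Section HNN.
Variables (S : choiceType) (R : set (word S)) (A : groupClosed (pres_group R)).
Variable f : {multiplicative pres_group R -> pres_group R}.
Local Notation K := (pres_group R).
Local Notation G := (hnn_group A f).
Local Notation cls := (pres_class (hnn_relators A f)).

Lemma pres_eq_hnn_word u v :
  pres_eq R u v -> pres_eq (hnn_relators A f) (hnn_word u) (hnn_word v).
Proof.
elim=> {u v} [u|u v _|u v x _ uv _ vx|u v s b|u v r Rr].
- exact: pres_refl.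
- exact: pres_sym.
- exact: pres_trans uv vx.
- by rewrite /hnn_word !map_cat; apply: pres_cancel.
- by rewrite /hnn_word !map_cat; apply: pres_relator; left; exists r.
Qed.

Definition hnn_base (k : K) : G := cls (hnn_word (repr k)).

Definition stable (b : bool) : G := cls [:: (None, b)].

Lemma hnn_base_class u : hnn_base (pres_class R u) = cls (hnn_word u).
Proof. exact/pres_classP/pres_eq_hnn_word/pres_eq_repr. Qed.

Lemma hnn_baseM : {morph hnn_base : k l / k * l}.
Proof.
move=> k l; rewrite -[k]pres_class_repr -[l]pres_class_repr -pres_classM.
by rewrite !hnn_base_class /hnn_word map_cat pres_classM.
Qed.

Lemma hnn_base1 : hnn_base 1 = 1.
Proof. by apply: (mulgI (hnn_base 1)); rewrite -hnn_baseM !mulg1. Qed.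

Lemma stableK b : stable b * stable (~~ b) = 1.
Proof. exact: pres_class_letterV. Qed.

Lemma stable_conj a : a \in A ->
  stable false * hnn_base a * stable true = hnn_base (f a).
Proof.
move=> Aa; apply: divg1_eq.
rewrite -[a]pres_class_repr -[f _]pres_class_repr !hnn_base_class.
rewrite -pres_classV /stable -(pres_classM _ [:: (None, false)]).
rewrite -(pres_classM _ _ [:: (None, true)]) -pres_classM.
apply: pres_class_relator.
right; exists (repr a), (repr (f a)).
by rewrite !pres_class_repr; split=> //=; rewrite -catA.
Qed.

Lemma pinch_base b k b' : pinch A f b k b' ->
  exists l, stable b * hnn_base k * stable b' = hnn_base l.
Proof.
case: b => -[-> /=]; last by move=> Ak; exists (f k); apply: stable_conj.
case=> a Aa ->; exists a; rewrite -stable_conj // !mulgA stableK mul1g.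
by rewrite -mulgA stableK mulg1.
Qed.

(** The pair of k and [:: (b1, k1); ...; (br, kr)] encodes the word
k t^b1 k1 ... t^br kr. *)
Fixpoint hnn_val (k : K) (s : seq (bool * K)) : G :=
  if s is (b, k') :: s' then hnn_base k * (stable b * hnn_val k' s')
  else hnn_base k.

Fixpoint reduced (s : seq (bool * K)) : Prop :=
  if s is (b, k) :: s' then
    (if s' is (b', _) :: _ then ~ pinch A f b k b' else True) /\ reduced s'
  else True.

Lemma hnn_val_mul k l s : hnn_val (k * l) s = hnn_base k * hnn_val l s.
Proof. by case: s => [|[b m] s] /=; rewrite hnn_baseM -?mulgA. Qed.

(** Words are read from the right: a letter t^b put in front of a reduced word
creates at most one pinch, and contracting it leaves a tail of the reduced
word, which is reduced. *)
Lemma reduced_form (g : G) : exists k s, reduced s /\ g = hnn_val k s.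
Proof.
rewrite -[g]pres_class_repr; elim: (repr g) => [|[[x|] b] w [k [s [s_red wE]]]].
- by exists 1, [::]; rewrite /= hnn_base1.
- exists (pres_class R [:: (x, b)] * k), s; split=> //.
  by rewrite hnn_val_mul -wE hnn_base_class -pres_classM.
have -> : cls ((None, b) :: w) = stable b * hnn_val k s.
  by rewrite -wE -pres_classM.
case: s s_red {wE} => [|[b' l] s] s_red.
  by exists 1, [:: (b, k)]; rewrite /= hnn_base1 mul1g.
case: (pselect (pinch A f b k b')) => [bkb'|nbkb'].
  have [m mE] := pinch_base bkb'; exists (m * l), s.
  by split; [case: s_red | rewrite hnn_val_mul -mE /= !mulgA].
exists 1, [:: (b, k), (b', l) & s].
by split=> //=; rewrite hnn_base1 mul1g.
Qed.

(** The universal property of the HNN-extension, for actions. *)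
Lemma hnn_action (V : zmodType) (act : K -> V -> V) (T : bool -> V -> V) :
  additive_action act -> (forall b, {morph T b : u v / (u + v)%R}) ->
  (forall b, cancel (T (~~ b)) (T b)) ->
  (forall a v, a \in A -> T false (act a v) = act (f a) (T false v)) ->
  exists hact : G -> V -> V,
    [/\ additive_action hact, forall k, hact (hnn_base k) =1 act k &
        forall b, hact (stable b) =1 T b].
Proof.
move=> [act1 actM actD] TD TK Tact.
pose letter (l : option S * bool) : V -> V :=
  if l.1 is Some s then act (pres_class R [:: (s, l.2)]) else T l.2.
pose ev w v := foldr letter v w.
have ev_cat u w v : ev (u ++ w) v = ev u (ev w v) by rewrite /ev foldr_cat.
have ev_base u v : ev (hnn_word u) v = act (pres_class R u) v.
  elim: u => [|[s b] u IHu] /=; first by rewrite act1.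
  by rewrite /letter /= IHu -actM -pres_classM.
have ev_relator r v : hnn_relators A f r -> ev r v = v.
  case=> [[u Ru ->]|[u [w [Au fu ->]]]].
    by rewrite ev_base pres_class_relator.
  rewrite winv_hnn_word !ev_cat !ev_base /= /letter /= Tact // fu TK.
  by rewrite -actM -pres_classM; have /pres_classP -> := pres_eq_winvr R w.
have ev_eq u w : pres_eq (hnn_relators A f) u w -> ev u =1 ev w.
  elim=> {u w} [u|u w _ uw|u w x _ uw _ wx|u w s b|u w r Rr] v //.
  - by rewrite uw wx.
  - rewrite !ev_cat /=; congr (ev u); case: s => [s|] /=; rewrite /letter /=.
      by rewrite -actM pres_class_letterV act1.
    exact: TK.
  - by rewrite !ev_cat (ev_relator _ _ Rr).
pose hact (g : G) := ev (repr g).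
have hactE w : hact (cls w) =1 ev w by apply/ev_eq/pres_eq_repr.
exists hact; split=> [|k v|b v]; last 2 first.
- by rewrite hactE ev_base pres_class_repr.
- by rewrite hactE.
split=> [v|g h v|g]; first exact: hactE [::] v.
  rewrite -[g]pres_class_repr -[h]pres_class_repr -pres_classM.
  by rewrite !hactE ev_cat.
rewrite /hact; elim: (repr g) => [|l w IHw] u v //=.
by rewrite IHw /letter; case: l.1 => [s|]; rewrite ?actD ?TD.
Qed.
End HNN.

(** * Reflections with inner products at most -2 *)

(** The forms e p, for p in X, are the pairings with the vectors of a root
system, among which e p0 is the pairing with beta; the points of Stab are those
whose vector is beta itself. *)
Section PingPong.
Local Open Scope ring_scope.
Variables (X : Type) (V : zmodType) (e : X -> V -> int) (p0 : X).
Variables (Stab : X -> Prop) (beta one : V).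
Hypotheses (eD : forall p, {morph e p : u v / u + v})
  (e0_beta : e p0 beta = 2)
  (e_beta : forall p, ~ Stab p -> e p beta <= -2)
  (e_stab : forall p v, Stab p -> e p v = e p0 v)
  (e_one : forall p, e p one = 1).

Definition reflection (v : V) : V := v - beta *~ e p0 v.

Lemma e_refl p v : e p (reflection v) = e p v - e p0 v * e p beta.
Proof.
rewrite /reflection -mulrNz eD (morphD_Mz (eD p)) -mulrzr intz mulrN.
by rewrite [e p beta * _]mulrC.
Qed.

Lemma reflD : {morph reflection : u v / u + v}.
Proof. by move=> u v; rewrite /reflection eD mulrzDr opprD addrACA. Qed.

Lemma reflK : involutive reflection.
Proof.
have reflE u : reflection u = u - beta *~ e p0 u by [].
move=> v; rewrite reflE e_refl e0_beta reflE -addrA -opprD -mulrzDr.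
have -> : e p0 v + (e p0 v - e p0 v * 2) = 0 by ring.
by rewrite mulr0z subr0.
Qed.

(** The vector lies on the negative side of the wall of beta, and on the
positive side of all others by a margin that survives the next reflection. *)
Definition flipped (v : V) : Prop :=
  e p0 v < 0 /\ forall p, ~ Stab p -> 0 < e p v + e p0 v.

Lemma flipped_refl v : 0 < e p0 v ->
  (forall p, ~ Stab p -> 0 < e p v + e p0 v) -> flipped (reflection v).
Proof.
move=> v0 vp; split=> [|p np]; rewrite !e_refl e0_beta; first by lia.
have := vp _ np; have := e_beta np; nia.
Qed.

(** If x moves the wall of beta to another wall, then x v has a positive value
at p0, and x v is negative at most on one other wall, where its value is that
of v at p0, which the margin compensates. *)
Lemma flipped_next (x : V -> V) (xs : X -> X) v :
  (forall p u, e p (x u) = e (xs p) u) -> ~ Stab (xs p0) ->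
  flipped v -> flipped (reflection (x v)).
Proof.
move=> xE n0 [v0 vp]; have x0 := vp _ n0.
apply: flipped_refl => [|p np]; rewrite !xE; first by lia.
case: (pselect (Stab (xs p))) => [/e_stab ->|/vp]; first by lia.
by lia.
Qed.

Lemma flipped_first (x : V -> V) (xs : X -> X) :
  (forall p u, e p (x u) = e (xs p) u) -> flipped (reflection (x one)).
Proof. by move=> xE; apply: flipped_refl => [|p _]; rewrite !xE !e_one. Qed.

Lemma not_flipped_image_one (x : V -> V) (xs : X -> X) :
  (forall p u, e p (x u) = e (xs p) u) -> ~ flipped (x one).
Proof. by move=> xE [+ _]; rewrite xE e_one. Qed.

End PingPong.

(** * The reflection representation *)

Lemma iter_modn (T : Type) (g : T -> T) (m n : nat) :
  iter m g =1 id -> iter (n %% m) g =1 iter n g.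
Proof.
move=> gm x; rewrite {2}(divn_eq n m) addnC iterD; congr (iter _ g _).
by elim: (n %/ m)%N => [|q IHq] //; rewrite mulSn iterD -IHq gm.
Qed.

Section Induced.
Variables (K : groupType) (A : {pred K}) (f : {multiplicative K -> K}).
Variables (m : nat) (V : vectType int) (act : K -> V -> V) (ev : V -> int).
Variable b : V.
Hypotheses (fm : iter m.+2 f =1 id).
Hypothesis (sep : separating_coef (fun k => k \in A) act ev b).

Let act1 : forall v, act 1 v = v. Proof. by case: (sep_action sep). Qed.
Let actM : forall g h v, act (g * h) v = act g (act h v).
Proof. by case: (sep_action sep). Qed.
Let actD : forall g, {morph act g : u v / (u + v)%R}.
Proof. by case: (sep_action sep). Qed.

Definition induced_module :=
  [the vectType int of {ffun 'I_m.+2 -> (int^o * V)%type}].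
Local Notation W := induced_module.

Definition induced_act (k : K) (w : W) : W :=
  [ffun i => ((w i).1, act (iter i f k) (w i).2)].
Definition shift (w : W) : W := [ffun i => w (ordS i)].
Definition unshift (w : W) : W := [ffun i => w (ord_pred i)].

(** A vector is viewed as a function on the points (i, k); the last argument of
ev is translated by k itself, since f ^ i is applied by induced_act. *)
Definition value (p : 'I_m.+2 * K) (w : W) : int :=
  ((w p.1).1 + ev (act p.2 (w p.1).2))%R.
Definition basepoint : 'I_m.+2 * K := (ord0, 1).
Definition refl_root : W :=
  [ffun i => if i == ord0 then (2, b *~ (-4)) else (-2, 0)]%R.
Definition const_one : W := [ffun=> (1, 0)]%R.
Definition stabpoint (p : 'I_m.+2 * K) := p.1 = ord0 /\ p.2 \in A.

Let ev0 : ev 0%R = 0%R.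
Proof. by have /(_ 0%R 0%R) := morphD_Mz (sep_evD sep); rewrite !mulr0z. Qed.
Let act0 k : act k 0%R = 0%R.
Proof. by have /(_ 0%R 0%R) := morphD_Mz (actD k); rewrite !mulr0z. Qed.

Lemma valueD p : {morph value p : u v / (u + v)%R}.
Proof.
by move=> u v; rewrite /value ffunE /= actD (sep_evD sep) addrACA.
Qed.

Lemma value_refl_root k :
  value (ord0, k) refl_root = (2 - 4 * ev (act k b))%R.
Proof.
rewrite /value ffunE eqxx /= (morphD_Mz (actD k)) (morphD_Mz (sep_evD sep)).
by rewrite -mulrzr intz mulrN mulrC.
Qed.

Lemma value_refl_root_basepoint : value basepoint refl_root = 2%R.
Proof. by rewrite value_refl_root act1 (sep_b0 sep). Qed.

Lemma value_refl_root_le p : ~ stabpoint p -> (value p refl_root <= -2)%R.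
Proof.
case: p => i k; rewrite /stabpoint /=.
have [-> nA|i_neq0 _] := eqVneq i ord0; last first.
  by rewrite /value ffunE (negbTE i_neq0) /= act0 ev0.
have /(sep_ge1 sep) : ~ k \in A by move=> kA; apply: nA.
by rewrite value_refl_root; lia.
Qed.

Lemma value_stab p w : stabpoint p -> value p w = value basepoint w.
Proof.
case: p => i k [/= -> Ak].
by rewrite /value /= (sep_ev_inv sep) // act1.
Qed.

Lemma value_const_one p : value p const_one = 1%R.
Proof. by rewrite /value ffunE /= act0 ev0 addr0. Qed.

Lemma value_act p k w :
  value p (induced_act k w) = value (p.1, p.2 * iter p.1 f k) w.
Proof. by rewrite /value ffunE /= actM. Qed.

Lemma value_shift p w : value p (shift w) = value (ordS p.1, p.2) w.
Proof. by rewrite /value ffunE. Qed.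

Lemma value_unshift p w : value p (unshift w) = value (ord_pred p.1, p.2) w.
Proof. by rewrite /value ffunE. Qed.

Lemma shiftK : cancel shift unshift.
Proof. by move=> w; apply/ffunP => i; rewrite !ffunE ord_predK. Qed.

Lemma unshiftK : cancel unshift shift.
Proof. by move=> w; apply/ffunP => i; rewrite !ffunE ordSK. Qed.

Lemma shift_act k w : shift (induced_act k w) = induced_act (f k) (shift w).
Proof.
apply/ffunP => i; rewrite !ffunE /=.
by rewrite -iterSr (iter_modn i.+1 fm).
Qed.

Lemma induced_action : additive_action induced_act.
Proof.
have f1 : f 1 = 1 by apply: (mulgI (f 1)); rewrite -gmulfM !mulg1.
split=> [w|g h w|g u v]; apply/ffunP => i; rewrite !ffunE /=.
- have -> : iter i f 1 = 1 by elim: (i : nat) => //= n ->.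
  by rewrite act1; case: (w i).
- have -> : iter i f (g * h) = iter i f g * iter i f h.
    by elim: (i : nat) => //= n ->; rewrite gmulfM.
  by rewrite actM.
- by rewrite actD.
Qed.

Local Notation r := (reflection value basepoint refl_root).

Lemma refl_act a w : a \in A -> r (induced_act a w) = induced_act a (r w).
Proof.
move=> Aa; have rootA : induced_act a refl_root = refl_root.
  apply/ffunP => i; rewrite !ffunE; case: eqP => [->|_] /=.
    by rewrite (morphD_Mz (actD a)) (sep_b_inv sep).
  by rewrite act0.
have [_ _ iD] := induced_action.
rewrite /reflection iD -!mulrNz (morphD_Mz (iD a)) rootA value_act /= mul1g.
by rewrite (@value_stab (ord0, a)).
Qed.

Definition stable_op (c : bool) (w : W) : W :=
  if c then r (unshift w) else shift (r w).

Lemma stable_opD c : {morph stable_op c : u v / (u + v)%R}.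
Proof.
have rD : {morph r : u v / (u + v)%R} by apply: reflD; apply: valueD.
have sD : {morph shift : u v / (u + v)%R}.
  by move=> u v; apply/ffunP => i; rewrite !ffunE.
have uD : {morph unshift : u v / (u + v)%R}.
  by move=> u v; apply/ffunP => i; rewrite !ffunE.
by case: c => u v /=; rewrite ?uD rD ?sD.
Qed.

Lemma stable_opK c : cancel (stable_op (~~ c)) (stable_op c).
Proof.
have rK : involutive r.
  by apply: reflK; [apply: valueD | apply: value_refl_root_basepoint].
by case: c => w /=; rewrite ?shiftK rK ?unshiftK.
Qed.

Lemma stable_op_act a w : a \in A ->
  stable_op false (induced_act a w) = induced_act (f a) (stable_op false w).
Proof. by move=> Aa; rewrite /= refl_act // shift_act. Qed.

Local Notation flip := (flipped value basepoint stabpoint).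

(** After a letter t = shift o reflection the last operation is a shift, which
has to be undone to see the flipped vector. *)
Definition state (c : bool) (w : W) := if c then flip w else flip (unshift w).

Lemma state_first c k : state c (stable_op c (induced_act k const_one)).
Proof.
have first := flipped_first valueD value_refl_root_basepoint
  value_refl_root_le value_const_one.
case: c => /=; last rewrite shiftK.
  apply: (first (fun w => unshift (induced_act k w))
            (fun p => (ord_pred p.1, p.2 * iter (ord_pred p.1) f k))) => p u.
  by rewrite value_unshift value_act.
by apply: (first _ (fun p => (p.1, p.2 * iter p.1 f k))) => p u; rewrite value_act.
Qed.

(** The operator between two successive reflections maps the base point to
(0, k) or (0, f^-1 k) when the letters are opposite, and to a point of index
1 or -1 when they are equal. *)
Lemma state_next c k c' w : ~ pinch A f c k c' -> state c' w ->
  state c (stable_op c (induced_act k w)).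
Proof.
have next := flipped_next valueD value_refl_root_basepoint
  value_refl_root_le value_stab.
have ordS0 : ordS ord0 <> ord0 :> 'I_m.+2 by move/(congr1 val).
have ord_pred0 : ord_pred ord0 <> ord0 :> 'I_m.+2.
  by move/(congr1 (@ordS _)); rewrite ord_predK => /esym.
move=> npinch; case: c' npinch => npinch flip_w; last rewrite -[w]unshiftK.
  case: c npinch => npinch /=; last rewrite shiftK.
    apply: (next (fun w => unshift (induced_act k w))
            (fun p => (ord_pred p.1, p.2 * iter (ord_pred p.1) f k))) => //.
      by move=> p u; rewrite value_unshift value_act.
    by case.
  apply: (next _ (fun p => (p.1, p.2 * iter p.1 f k))) => //.
    by move=> p u; rewrite value_act.
  by case=> /= _; rewrite mul1g => Ak; apply: npinch.
case: c npinch => npinch /=; last rewrite shiftK.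
  apply: (next (fun w => unshift (induced_act k (shift w)))
     (fun p => (p.1, p.2 * iter (ord_pred p.1) f k))) => //.
    by move=> p u; rewrite value_unshift value_act value_shift /= ord_predK.
  case=> /= _; rewrite mul1g => Ak; apply: npinch; split=> //.
  (* f ^ (m + 1) is the inverse of f. *)
  exists (iter m.+1 f k); last by rewrite -iterS fm.
  by move: Ak; rewrite modn_small.
apply: (next (fun w => induced_act k (shift w))
   (fun p => (ordS p.1, p.2 * iter p.1 f k))) => //.
  by move=> p u; rewrite value_act value_shift.
by case.
Qed.

Lemma state_neq_const_one c k w : state c w -> induced_act k w <> const_one.
Proof.
move=> cw kw; have [i1 iM _] := induced_action.
have {kw} wE : w = induced_act k^-1 const_one by rewrite -kw -iM mulVg i1.
have not_flip :=
  @not_flipped_image_one _ _ _ basepoint stabpoint _ value_const_one.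
case: c cw => /=; rewrite wE.
  apply: (not_flip _ (fun p => (p.1, p.2 * iter p.1 f k^-1))) => p u.
  by rewrite value_act.
apply: (not_flip (fun w => unshift (induced_act k^-1 w))
     (fun p => (ord_pred p.1, p.2 * iter (ord_pred p.1) f k^-1))) => p u.
by rewrite value_unshift value_act.
Qed.

End Induced.

(** * Faithful representations of HNN-extensions *)

(** Elements of K translate the hyperplane Z^n x 1 of Z^n x Z, and t acts
linearly on Z^n through f. *)
Lemma hnn_affine_action (S : choiceType) (R : set (word S))
    (A : groupClosed (pres_group R))
    (f : {multiplicative pres_group R -> pres_group R}) :
  fg_free_abelian (pres_group R) -> bijective f ->
  exists (W : vectType int) (hact : hnn_group A f -> W -> W),
    additive_action hact /\
    forall k, hact (hnn_base A f k) =1 id -> k = 1.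
Proof.
move=> [n [e [eD [e' e'K eK]]]] [f' f'K fK].
have e'M g h : e' (g * h) = (e' g + e' h)%R.
  by apply: (can_inj e'K); rewrite eD !eK.
have e'1 : e' 1 = 0%R by apply: (addrI (e' 1)); rewrite -e'M mulg1 addr0.
pose W := [the vectType int of ('rV[int]_n * int^o)%type].
pose act k (w : W) : W := (w.1 + e' k *~ w.2, w.2)%R.
pose T (c : bool) (w : W) : W := (e' ((if c then f' else f) (e w.1)), w.2).
have act_action : additive_action act.
  split=> [[x c]|g h [x c]|g [x c] [y d]]; rewrite /act /=.
  - by rewrite e'1 mul0rz addr0.
  - by rewrite e'M mulrzDl -addrA [(e' h *~ c + _)%R]addrC.
  - by rewrite mulrzDr addrACA.
have TD c : {morph T c : u v / (u + v)%R}.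
  move=> [x a] [y d]; rewrite /T /= eD; congr (_, _); case: c => /=.
    by rewrite (can2_gmulfM f'K fK) e'M.
  by rewrite gmulfM e'M.
have TK c : cancel (T (~~ c)) (T c).
  by case: c => -[x a]; rewrite /T /= eK ?f'K ?fK e'K.
have Tact a w : a \in A -> T false (act a w) = act (f a) (T false w).
  move=> _; case: w => x c; rewrite /T /act /=; congr (_, _).
  have F : {morph (fun y => e' (f (e y))) : u v / (u + v)%R}.
    by move=> u v; rewrite eD gmulfM e'M.
  by rewrite F (morphD_Mz F) eK.
have [hact [hact_action hact_base _]] := hnn_action act_action TD TK Tact.
exists W, hact; split=> // k /(_ (0, 1)%R).
rewrite hact_base /act /= add0r => -[k0].
by apply: (can_inj eK); rewrite e'1; exact: k0.
Qed.

Lemma hnn_reflection_action (S : choiceType) (R : set (word S))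
    (A : groupClosed (pres_group R))
    (f : {multiplicative pres_group R -> pres_group R}) (m : nat) :
  separable (fun k => k \in A) -> iter m.+2 f =1 id ->
  exists (W : vectType int) (hact : hnn_group A f -> W -> W),
    additive_action hact /\
    forall k s, reduced A f s -> hact (hnn_val A f k s) =1 id -> s = [::].
Proof.
move=> [V [act [ev [b sep]]]] fm.
have [hact [hact_action hact_base hact_stable]] :=
  hnn_action (induced_action f m sep) (stable_opD sep) (stable_opK sep)
    (stable_op_act fm sep).
exists (induced_module m V), hact; split=> // k s s_red.
have [_ hM _] := hact_action.
have reduced_state c l s' : reduced A f ((c, l) :: s') ->
    state A act ev c
      (hact (stable A f c * hnn_val A f l s') (const_one m V)).
  elim: s' c l => [|[c' l'] s' IHs] c l /=.
    by move=> _; rewrite hM hact_stable hact_base; apply: state_first.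
  move=> [np s'_red]; rewrite hM hact_stable hM hact_base.
  by apply: (state_next fm sep np); apply: IHs.
case: s s_red => // -[c l] s /reduced_state cst /(_ (const_one m V)).
by rewrite /= hM hact_base => /(state_neq_const_one sep cst).
Qed.

Theorem theorem4p1 (S : choiceType) (R : set (word S))
    (A : groupClosed (pres_group R))
    (f : {multiplicative pres_group R -> pres_group R}) :
  fg_free_abelian (pres_group R) ->
  bijective f ->
  (exists2 m : nat, (0 < m)%N & iter m f =1 id) ->
  Z_linear (hnn_group A f).
Proof.
move=> K_free f_bij [[|m] // _ fm].
(* If f = 1 the exponent 1 is allowed, but equal letters have to change the
index in Z/M; doubling the exponent ensures M >= 2. *)
have fm2 : iter (m + m).+2 f =1 id.
  by move=> k; rewrite -addnS -addSn iterD !fm.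
have [V [actV [[V1 VM VD] V_base]]] := hnn_affine_action A K_free f_bij.
have [W [actW [[W1 WM WD] W_reduced]]] :=
  hnn_reflection_action (separable_subgroup A K_free) fm2.
pose act g (x : V * W) := (actV g x.1, actW g x.2).
apply: (@Z_linear_of_action _ [the vectType int of (V * W)%type] act).
  split=> [[v w]|g h [v w]|g [v w] [v' w']]; rewrite /act /=.
  - by rewrite V1 W1.
  - by rewrite VM WM.
  - by rewrite VD WD.
move=> g act_g; have [k [s [s_red gE]]] := reduced_form g.
have actV_g v : actV g v = v by case: (act_g (v, 0%R)).
have actW_g w : actW g w = w by case: (act_g (0%R, w)).
have s0 : s = [::] by apply: (W_reduced k s s_red); rewrite -gE.
move: gE actV_g; rewrite s0 /= => -> /V_base ->.
exact: hnn_base1.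
Qed.
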